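(* Let $\mathcal H$ be an index set (possibly uncountably infinite). For each $h\in\mathcal H$ let $X_1(h),X_2(h),\dots$ be real random variables, and let $\mathcal T_t=\{X_\tau(h)\}_{1\le\tau\le t,\,h\in\mathcal H}$ denote everything observed up to time $t$. Assume $\mathbb E[X_t(h)\mid\mathcal T_{t-1}]=0$ for all $t,h$ (the variables $X_t(h)$ for different $h$ need not be independent), and $|X_t(h)|\le C$ for all $t,h$. Let $M_t(h)=\sum_{\tau=1}^t X_\tau(h)$ and $V_t(h)=\sum_{\tau=1}^t\mathbb E[X_\tau(h)^2\mid\mathcal T_{\tau-1}]$, and for a distribution $\rho$ on $\mathcal H$ let $M_t(\rho)=\mathbb E_{\rho(h)}[M_t(h)]$, $V_t(\rho)=\mathbb E_{\rho(h)}[V_t(h)]$. Let $\delta\in(0,1)$ and $L_t=2\ln(t+1)+\ln\frac{2}{\delta}$. Let $\mu_1,\mu_2,\dots$ be ''reference'' (prior) distributions on $\mathcal H$ such that $\mu_t$ is independent of $\mathcal T_t$ (it may depend on $t$), and let $\bar V_1,\bar V_2,\dots$ be positive numbers such that $\bar V_t$ is independent of $\mathcal T_t$ (it may depend on $t$) and $$\sqrt{\frac{L_t}{(e-2)\bar V_t}}\le\frac1C\quad\text{for all }t.$$ Then with probability at least $1-\delta$, simultaneously for all $t\ge1$ and all distributions $\rho_t$ on $\mathcal H$ (which may depend on the observations), $$|M_t(\rho_t)|\le\sqrt{e-2}\left(KL(\rho_t\|\mu_t)\sqrt{\frac{\bar V_t}{L_t}}+V_t(\rho_t)\sqrt{\frac{L_t}{\bar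 V_t}}+\sqrt{L_t\bar V_t}\right).$$
   Context: $KL(\rho\|\mu)=\mathbb E_{\rho(h)}[\ln\frac{\rho(h)}{\mu(h)}]$ is the Kullback–Leibler divergence. ''Independent of $\mathcal T_t$'' means the object is chosen without reference to the observed random variables (e.g., fixed in advance as a function of $t$). *)

(* Defs.v *)
From HB Require Import structures.
From mathcomp Require Import all_boot all_order all_algebra.
From mathcomp Require Import all_classical all_reals all_analysis.
Set Implicit Arguments. Unset Strict Implicit. Unset Printing Implicit Defensive.
Import Order.TTheory GRing.Theory Num.Theory.
Import numFieldNormedType.Exports.
Local Open Scope classical_set_scope.
Local Open Scope ring_scope.

Definition obs_gen {dH d} {H : measurableType dH} {Omega : measurableType d}
  {R : realType} (X : nat -> H -> Omega -> R) (t : nat) : set (set Omega) :=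
  [set A | exists tau h (B : set R),
     [/\ (1 <= tau <= t)%N, measurable B & A = X tau h @^-1` B]].

Definition obs_sigma {dH d} {H : measurableType dH} {Omega : measurableType d}
  {R : realType} (X : nat -> H -> Omega -> R) (t : nat) : set (set Omega) :=
  <<s obs_gen X t >>.

Definition sub_measurable {d} {Omega : measurableType d} {R : realType}
  (G : set (set Omega)) (g : Omega -> R) : Prop :=
  forall B : set R, measurable B -> G (g @^-1` B).

Definition is_cond_exp {d} {Omega : measurableType d} {R : realType}
  (P : probability Omega R) (G : set (set Omega)) (f g : Omega -> R) : Prop :=
  [/\ P.-integrable setT (EFin \o f),
      P.-integrable setT (EFin \o g),
      sub_measurable G g &
      forall A, G A ->
        (\int[P]_(w in A) (f w)%:E = \int[P]_(w in A) (g w)%:E)%E].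

Definition KL {dH} {H : measurableType dH} {R : realType}
  (rho mu : probability H R) : \bar R :=
  if pselect (charge_of_finite_measure rho `<< mu) then
    (\int[rho]_h (ln (fine (Radon_Nikodym (charge_of_finite_measure rho) mu h)))%:E)%E
  else +oo%E.

Definition Lt {R : realType} (delta : R) (t : nat) : R :=
  2 * ln (t.+1%:R) + ln (2 / delta).

(* Main.v *)
(** For |x| <= 1 one has e^x <= 1 + x + (e - 2) x^2, so for |s| <= 1/C the process
    exp(s M_t(h) - (e - 2) s^2 V_t(h)) is a supermartingale and has expectation at
    most 1.  Averaging over h under mu_t (Tonelli) and Markov's inequality bound
    the probability that the average exceeds e^{L_t} by delta / (2 (t + 1)^2); the
    sum over both signs s = +-sqrt(L_t / ((e - 2) Vbar_t)) and all t >= 1 is at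
    most delta.  Off this event the Donsker-Varadhan inequality
    E_rho[phi] <= KL(rho || mu) + ln E_mu[e^phi] applied to
    phi = s M_t - (e - 2) s^2 V_t gives the bound for every rho at once. *)
Require Import Defs.
From HB Require Import structures.
From mathcomp Require Import all_boot all_order all_algebra.
From mathcomp Require Import all_classical all_reals all_analysis.
From mathcomp Require Import ring lra measurable_realfun.
Import Order.TTheory GRing.Theory Num.Theory.
Import numFieldNormedType.Exports.
Local Open Scope classical_set_scope.
Local Open Scope ring_scope.

(** * Quadratic upper bound on the exponential *)

Lemma expR1_gt2 (R : realType) : 2 < expR 1 :> R.
Proof. by have := @expR_gt1Dx R 1 (oner_neq0 _); rewrite -natr1. Qed.

(** Termwise comparison of power series: for n >= 2 and |x| <= 1, x^n / n! <= x^2 / n!, and the 1 /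
    n! with n >= 2 sum to e - 2. *)
Lemma expR_le_quadratic (R : realType) (x : R) : `|x| <= 1 ->
  expR x <= 1 + x + (expR 1 - 2) * x ^+ 2.
Proof.
move=> x1.
have cvgS (y : R) : series (exp_coeff y) n.+2 @[n --> \oo] --> expR y.
  have := @is_cvg_series_exp_coeff R y; rewrite -/(expR y).
  by rewrite -(cvg_shiftn 2); under eq_fun do rewrite addn2.
have partial n : series (exp_coeff x) n.+2 <=
    1 + x + (series (exp_coeff 1) n.+2 - 2) * x ^+ 2.
  elim: n => [|n IH].
    rewrite /series/= !big_nat_recr//= !big_geq// /exp_coeff/=.
    by rewrite !expr0 !expr1 !fact0 !divr1 !add0r subrr mul0r addr0.
  rewrite ![series _ n.+3]big_nat_recr//= -![\sum_(0 <= i < n.+2) _]/(series _ n.+2).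
  suff : exp_coeff x n.+2 <= exp_coeff 1 n.+2 * x ^+ 2 by move: IH; lra.
  rewrite /exp_coeff/= expr1n div1r mulrC ler_wpM2l ?invr_ge0//.
  rewrite (le_trans (ler_norm _))// normrX -[leRHS]ger0_norm ?sqr_ge0// normrX.
  by rewrite -addn2 exprD ler_piMl ?sqr_ge0// exprn_ile1.
apply: (ler_cvg_to (cvgS x) _ (nearW _ partial)).
by apply: cvgD; [exact: cvg_cst|apply: cvgMr_tmp; apply: cvgB => //; exact: cvg_cst].
Qed.

(** * Pulling a measurable factor out of a conditional expectation *)

Lemma measurable_max0 (R : realType) :
  measurable_fun setT (fun x : R => (Num.max 0 x)%:E).
Proof. by apply/measurable_EFinP; exact: measurable_maxr. Qed.

Section simple_pull_out.
Import HBNNSimple.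

(** The approximation lives on the real line and is composed with [G] afterwards, so that its level
    sets pull back to preimages of Borel sets under [G]. The positive part equals the identity on
    the values of a nonnegative [G]. *)
Definition simple_max0 (R : realType) : {nnsfun R >-> R}^nat :=
  nnsfun_approx measurableT (@measurable_max0 R).

(* The right-hand side depends on [f] only through its integrals over the sets
   [G @^-1` B], which is what conditioning controls. *)
Lemma ge0_integralM_lim d (T : measurableType d) (R : realType)
    (m : {measure set T -> \bar R}) (G f : T -> R) :
  measurable_fun setT G -> measurable_fun setT f ->
  (forall x, 0 <= G x) -> (forall x, 0 <= f x) ->
  (\int[m]_x (G x * f x)%:E = limn (fun n =>
     \sum_(y \in range (@simple_max0 R n)) (y%:E *
        \int[m]_(x in G @^-1` (@simple_max0 R n @^-1` [set y])) (f x)%:E)))%E.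
Proof.
move=> mG mf G0 f0; set h := @simple_max0 R.
have mhG n : measurable_fun setT (fun x => (h n (G x))) by exact: measurableT_comp.
have hG x : (h n (G x) * f x)%:E @[n --> \oo] --> (G x * f x)%:E.
  rewrite EFinM; under eq_fun do rewrite EFinM.
  apply: cvgeZr => //.
  have := @cvg_nnsfun_approx _ _ R setT measurableT _ (@measurable_max0 R) _ (G x) I.
  rewrite (max_idPr _)//; apply => y _.
  by rewrite lee_fin le_max lexx.
transitivity (limn (fun n => \int[m]_x (h n (G x) * f x)%:E))%E.
  rewrite -monotone_convergence//.
  - by apply: eq_integral => x _; apply/esym/cvg_lim => //; exact: hG.
  - by move=> n; apply/measurable_EFinP; exact: measurable_funM.
  - by move=> n x _; rewrite lee_fin mulr_ge0.
  - move=> x _ a b ab; rewrite lee_fin ler_wpM2r//.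
    exact/lefP/nd_nnsfun_approx.
congr (limn _); apply/funext => n.
transitivity (\int[m]_x (\sum_(y \in range (h n))
    (y * \1_(G @^-1` (h n @^-1` [set y])) x * f x)%:E))%E.
  apply: eq_integral => x _; rewrite [in LHS]fimfunE.
  rewrite EFinM -fsumEFin// ge0_mule_fsuml//.
  by move=> y; rewrite lee_fin; exact: nnfun_muleindic_ge0.
have mB y : measurable (G @^-1` (h n @^-1` [set y])).
  by rewrite -[X in measurable X]setTI; exact: mG.
rewrite ge0_integral_fsum//; last 2 first.
- move=> y; apply/measurable_EFinP; apply: measurable_funM => //.
  by apply: measurable_funM => //; exact: measurable_indic.
- move=> y x _; rewrite lee_fin mulr_ge0//.
  by have := @nnfun_muleindic_ge0 _ _ _ (h n) y (G x).
apply: eq_fsbigr => y; rewrite inE => -[z _ hz].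
rewrite [in RHS]integral_mkcond -ge0_integralZl_EFin//.
- apply: eq_integral => x _; rewrite -mulrA EFinM; congr (_ * _)%E.
  rewrite patchE indicE; case: ifPn => _; by rewrite ?mul1r ?mul0r.
- by move=> x _; rewrite patchE; case: ifPn => // _; rewrite lee_fin.
- by apply/(measurable_restrictT _ _).1 => //; exact/measurable_EFinP/measurable_funTS.
- by rewrite -hz.
Qed.

(** Both sides are limits of the same finite sums, in which [f] and [g] enter only through their
    equal integrals over preimages under [G]. *)
Lemma ge0_integralM_preimage d (T : measurableType d) (R : realType)
    (m : {measure set T -> \bar R}) (G f g : T -> R) :
  measurable_fun setT G -> measurable_fun setT f -> measurable_fun setT g ->
  (forall x, 0 <= G x) -> (forall x, 0 <= f x) -> (forall x, 0 <= g x) ->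
  (forall B, measurable B ->
    \int[m]_(x in G @^-1` B) (f x)%:E = \int[m]_(x in G @^-1` B) (g x)%:E)%E ->
  (\int[m]_x (G x * f x)%:E = \int[m]_x (G x * g x)%:E)%E.
Proof.
move=> mG mf mg G0 f0 g0 fg; rewrite !ge0_integralM_lim//.
congr (limn _); apply/funext => n; apply: eq_fsbigr => y _.
congr (_ * _)%E; apply: fg; rewrite -[X in measurable X]setTI.
exact: (@measurable_funPT _ _ _ _ (@simple_max0 R n)).
Qed.

End simple_pull_out.

(** * One step of the exponential supermartingale *)

Lemma measurable_sum_nat d (T : measurableType d) (R : realType)
    (f : nat -> T -> R) (m n : nat) :
  (forall i, (m <= i < n)%N -> measurable_fun setT (f i)) ->
  measurable_fun setT (fun x => \sum_(m <= i < n) f i x).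
Proof.
move=> mf.
rewrite (_ : (fun _ => _) = fun x =>
  \sum_(m <= i < n) (if (m <= i < n)%N then f i x else 0)).
  apply: measurable_sum => i.
  have [imn|_] := boolP (m <= i < n)%N; [exact: mf|exact: measurable_cst].
by apply/funext => x; rewrite big_nat big_mkcond.
Qed.

(** Lets closure of measurability under sums, products and composition be used for the generated
    sigma-algebra. *)
Lemma sub_measurableP d (Omega : measurableType d) (R : realType)
    (S : set (set Omega)) (g : Omega -> R) :
  sub_measurable <<s S >> g <->
  measurable_fun setT (g : g_sigma_algebraType S -> R).
Proof.
split=> [mg _ B mB|mg B mB]; first by rewrite setTI; exact: mg.
by have := mg measurableT B mB; rewrite setTI.
Qed.

Section supermartingale_step.
Context d (Omega : measurableType d) (R : realType) (P : probability Omega R).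
Variable S : set (set Omega).
Hypothesis Smeas : S `<=` measurable.

Lemma sub_sigma_measurable : <<s S >> `<=` measurable.
Proof. by apply: smallest_sub => //; exact: sigma_algebra_measurable. Qed.

Lemma sub_measurable_measurable (g : Omega -> R) :
  sub_measurable <<s S >> g -> measurable_fun setT g.
Proof.
by move=> mg _ B mB; rewrite setTI; apply: sub_sigma_measurable; exact: mg.
Qed.

(** With c = (e - 2) s^2 and the past-measurable weight G = W e^(-c v): e^(sX) is at most f = 1 + sX
    + cX^2, conditioning turns f into g = 1 + cv, and (1 + cv) e^(-cv) <= 1. *)
Lemma expR_supermartingale_step (X v W : Omega -> R) (s : R) :
  is_cond_exp P <<s S >> X (fun _ => 0) ->
  is_cond_exp P <<s S >> (fun w => X w ^+ 2) v ->
  (forall w, 0 <= v w) -> (forall w, `|s * X w| <= 1) ->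
  sub_measurable <<s S >> W -> (forall w, 0 <= W w) ->
  (\int[P]_w (W w * expR (s * X w - (expR 1 - 2) * s ^+ 2 * v w))%:E <=
   \int[P]_w (W w)%:E)%E.
Proof.
move=> [iX _ _ EX] [iX2 iv mv EX2] v0 sX1 mW W0.
set c := (expR 1 - 2) * s ^+ 2.
have c0 : 0 <= c by rewrite mulr_ge0 ?sqr_ge0// subr_ge0 ltW// expR1_gt2.
pose G w := W w * expR (- (c * v w)).
have G0 w : 0 <= G w by rewrite mulr_ge0 ?expR_ge0.
have mG : sub_measurable <<s S >> G.
  apply/sub_measurableP; apply: measurable_funM; first exact/sub_measurableP.
  apply: (measurableT_comp (@measurable_expR R)).
  apply: (measurableT_comp (@oppr_measurable R setT)).
  by apply: measurable_funM => //; exact/sub_measurableP.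
pose f w := 1 + s * X w + c * X w ^+ 2.
pose g w := 1 + c * v w.
have mX : measurable_fun setT X by apply/measurable_EFinP; case/integrableP: iX.
have f0 w : 0 <= f w.
  apply: addr_ge0; last by rewrite mulr_ge0 ?sqr_ge0.
  by have := sX1 w; rewrite ler_norml => /andP[+ _]; rewrite -lerBlDl sub0r.
have g0 u : 0 <= g u by rewrite /g addr_ge0// mulr_ge0.
have mf : measurable_fun setT f.
  apply: measurable_funD; first by apply: measurable_funD => //; exact: measurable_funM.
  by apply: measurable_funM => //; exact: measurable_funX.
have mv' := sub_measurable_measurable _ mv.
have mg : measurable_fun setT g.
  by apply: measurable_funD => //; exact: measurable_funM.
(* On a past event the term in X integrates to 0 and X^2 may be replaced by v; the pull-out lemma
   extends this to the weight [G]. *)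
have fgE : (\int[P]_w (G w * f w)%:E = \int[P]_w (G w * g w)%:E)%E.
  apply: ge0_integralM_preimage => //; first exact: sub_measurable_measurable.
  move=> B mB; set A := G @^-1` B.
  have GA : <<s S >> A by exact: mG.
  have mA : measurable A by exact: sub_sigma_measurable.
  have i1 : P.-integrable A (EFin \o cst 1).
    by apply: finite_measure_integrable_cst.
  have iA h : P.-integrable setT h -> P.-integrable A h.
    by apply: integrableS.
  have iZ (k : R) (h : Omega -> R) : P.-integrable setT (EFin \o h) ->
      P.-integrable A (EFin \o (fun w => k * h w)).
    move=> ih; rewrite (_ : _ \o _ = fun w => (k%:E * (h w)%:E)%E)//.
    by apply: integrableZl => //; exact: iA.
  transitivity (\int[P]_(w in A) (1%:E + (s * X w)%:E + (c * X w ^+ 2)%:E))%E.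
    by apply: eq_integral => w _; rewrite -!EFinD.
  rewrite integralD//; last 2 first.
  - by apply: integrableD => //; exact: iZ.
  - exact: (iZ c (fun w => X w ^+ 2)).
  rewrite integralD//; last exact: iZ.
  under [X in (_ + X + _)%E]eq_integral => w0 _ do rewrite EFinM.
  under [X in (_ + _ + X)%E]eq_integral => w0 _ do rewrite EFinM.
  rewrite !integralZl//; [|exact: (iA (EFin \o (fun w => X w ^+ 2)))|exact: (iA (EFin \o X))].
  rewrite EX// EX2// integral0 mule0 adde0.
  rewrite -integralZl//; last exact: (iA (EFin \o v)).
  by rewrite -integralD//; exact: (iZ c v).
have mW' := sub_measurable_measurable _ mW.
have mG' := sub_measurable_measurable _ mG.
apply: (@le_trans _ _ (\int[P]_w (G w * f w)%:E)%E).
  apply: ge0_le_integral => //= [w _|||w _].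
  - by rewrite lee_fin mulr_ge0 ?expR_ge0.
  - apply/measurable_EFinP; apply: measurable_funM => //.
    apply: (measurableT_comp (@measurable_expR R)).
    by apply: measurable_funB; exact: measurable_funM.
  - by apply/measurable_EFinP; exact: measurable_funM.
  - rewrite lee_fin expRD mulrCA mulrC -/(G w) ler_wpM2l//.
    rewrite (le_trans (expR_le_quadratic _ _ (sX1 w)))// /f /c.
    by rewrite exprMn mulrA.
rewrite fgE; apply: ge0_le_integral => //= [w _|||w _].
- by rewrite lee_fin mulr_ge0.
- by apply/measurable_EFinP; exact: measurable_funM.
- exact/measurable_EFinP.
- rewrite lee_fin /G -mulrA ler_piMr//.
  by rewrite expRN mulrC ler_pdivrMr ?expR_gt0// mul1r expR_ge1Dx.
Qed.

End supermartingale_step.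

(** * The supermartingale, its average over a prior, and Markov's inequality *)

Section mixture.
Context (R : realType) dH (H : measurableType dH) d (Omega : measurableType d).
Context (P : probability Omega R) (X v : nat -> H -> Omega -> R).
Hypothesis mX : forall t, (1 <= t)%N ->
  measurable_fun setT (fun p : H * Omega => X t p.1 p.2).
Hypothesis mv : forall t, (1 <= t)%N ->
  measurable_fun setT (fun p : H * Omega => v t p.1 p.2).
Hypothesis EX : forall t h, (1 <= t)%N ->
  is_cond_exp P (obs_sigma X t.-1) (X t h) (fun _ => 0).
Hypothesis EX2 : forall t h, (1 <= t)%N ->
  is_cond_exp P (obs_sigma X t.-1) (fun w => X t h w ^+ 2) (v t h).
Hypothesis v0 : forall t h w, (1 <= t)%N -> 0 <= v t h w.
Variable s : R.
Hypothesis sX1 : forall t h w, (1 <= t)%N -> `|s * X t h w| <= 1.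

(** Logarithm of the supermartingale. The parameter [s] stays fixed as time runs; its dependence on
    the final time is introduced only in the theorem. *)
Definition exponent (t : nat) (h : H) (w : Omega) : R :=
  s * \sum_(1 <= tau < t.+1) X tau h w
  - (expR 1 - 2) * s ^+ 2 * \sum_(1 <= tau < t.+1) v tau h w.

Lemma obs_gen_measurable t : obs_gen X t `<=` measurable.
Proof.
move=> _ [tau [h [B [/andP[tau1 _] mB ->]]]].
rewrite -[X in measurable X]setTI.
by have := measurable_fun_pair2 h (mX _ tau1); apply.
Qed.

Lemma obs_sigma_le t1 t2 : (t1 <= t2)%N -> obs_sigma X t1 `<=` obs_sigma X t2.
Proof.
move=> t12; apply: sub_sigma_algebra2 => _ [tau [h [B [/andP[tau1 tau2] mB ->]]]].
by exists tau, h, B; split => //; rewrite tau1 (leq_trans tau2).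
Qed.

(** Each v_tau is predictable: it is measurable already at time tau - 1, hence also at time t. *)
Lemma sub_measurable_exponent t h :
  sub_measurable (obs_sigma X t) (fun w => expR (exponent t h w)).
Proof.
apply/sub_measurableP.
apply: (measurableT_comp (@measurable_expR R)).
apply: measurable_funB; apply: measurable_funM => //;
    apply: measurable_sum_nat => tau /andP[tau1 taut]; apply/sub_measurableP.
- move=> B mB; apply: sub_sigma_algebra.
  by exists tau, h, B; split => //; rewrite tau1 -ltnS.
- move=> B mB; have [_ _ mvt _] := EX2 _ h tau1.
  apply: (@obs_sigma_le tau.-1); last exact: mvt.
  by rewrite (leq_trans (leq_pred _)) // -ltnS.
Qed.

(** Induction on time: the factor of time t + 1 is removed by the one-step inequality, conditioning
    on the observations up to t. *)
Lemma integral_exponent_le1 t h : (\int[P]_w (expR (exponent t h w))%:E <= 1)%E.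
Proof.
elim: t => [|t IH].
  under eq_integral => w _ do rewrite /exponent !big_geq// !mulr0 subr0 expR0.
    by rewrite integral_cst//= probability_setT mule1.
apply: le_trans IH.
under eq_integral => w _.
  rewrite /exponent !(big_nat_recr t.+1)//= !mulrDr opprD addrACA expRD.
  rewrite -/(exponent t h w); over.
apply: (expR_supermartingale_step _ _ _ P _ (obs_gen_measurable t) (X t.+1 h) (v t.+1 h)
  (fun w => expR (exponent t h w)) s).
- exact: EX.
- exact: EX2.
- by move=> w; exact: v0.
- by move=> w; exact: sX1.
- exact: sub_measurable_exponent.
- by move=> w; exact: expR_ge0.
Qed.

Lemma measurable_exponent t :
  measurable_fun setT (fun p : H * Omega => exponent t p.1 p.2).
Proof.
apply: measurable_funB; apply: measurable_funM => //;
  by apply: measurable_sum_nat => tau /andP[tau1 _]; (exact: mX || exact: mv).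
Qed.

Lemma measurable_expR_exponent t :
  measurable_fun setT (fun p : H * Omega => (expR (exponent t p.1 p.2))%:E).
Proof.
apply/measurable_EFinP; apply: (measurableT_comp (@measurable_expR R)).
exact: measurable_exponent.
Qed.

Definition mixture (m : probability H R) (t : nat) (w : Omega) : \bar R :=
  (\int[m]_h (expR (exponent t h w))%:E)%E.

Lemma measurable_mixture m t : measurable_fun setT (mixture m t).
Proof.
exact: (measurable_fun_fubini_tonelli_G _ (measurable_expR_exponent t)).
Qed.

(** Tonelli exchanges the two integrals. This is where independence of the prior from the data
    enters: [m] does not vary with the outcome. *)
Lemma integral_mixture_le1 m t : (\int[P]_w mixture m t w <= 1)%E.
Proof.
rewrite -(fubini_tonelli (fun p => (expR (exponent t p.1 p.2))%:E))//=.
- apply: (@le_trans _ _ (\int[m]_h (cst 1 h)))%E.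
    apply: ge0_le_integral => //= [h _||h _].
    + exact: integral_ge0.
    + exact: (measurable_fun_fubini_tonelli_F _ (measurable_expR_exponent t)).
    + exact: integral_exponent_le1.
    by rewrite integral_cst//= probability_setT mule1.
- exact: measurable_expR_exponent.
Qed.

Lemma mixture_tail m t (K : R) : 0 < K ->
  (P [set w | K%:E <= mixture m t w] <= K^-1%:E)%E.
Proof.
move=> K0.
have mix0 w : (0 <= mixture m t w)%E by exact: integral_ge0.
have := le_integral_abse P measurableT (measurable_mixture m t) K0.
under eq_integral => w _ do rewrite gee0_abs//.
rewrite setTI (_ : [set x | _] = [set w | (K%:E <= mixture m t w)%E]); last first.
  by apply/seteqP; split => w /=; rewrite gee0_abs.
move=> /le_trans /(_ (integral_mixture_le1 m t)).
by rewrite -lee_pdivlMl// mule1.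
Qed.

Lemma measurable_tail m t (K : R) : measurable [set w | (K%:E <= mixture m t w)%E].
Proof.
rewrite -[X in measurable X]setTI.
by apply: emeasurable_fun_c_infty => //; exact: measurable_mixture.
Qed.

End mixture.

(** * The Donsker-Varadhan inequality *)

(** Meant for [f] a log-density, whose integral may be infinite. The negative part of [f] lies below
    that of [g], so either [f] is integrable or its integral is +oo. *)
Lemma le_integral_integrable_minorant d (T : measurableType d) (R : realType)
    (m : {measure set T -> \bar R}) (g f : T -> \bar R) :
  m.-integrable setT g -> measurable_fun setT f -> (forall x, g x <= f x)%E ->
  (\int[m]_x g x <= \int[m]_x f x)%E.
Proof.
move=> ig mf gf.
have fnoo : (\int[m]_x f^\- x < +oo)%E.
  apply: le_lt_trans (integral_funeneg_lt_pinfty measurableT ig).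
  apply: ge0_le_integral => //; [exact: measurable_funeneg|
    by apply: measurable_funeneg; exact: measurable_int ig|].
  by move=> x _; rewrite !funenegE ge_max !le_max !lexx leeN2 gf orbT.
have [fpoo|] := ltP (\int[m]_x f^\+ x)%E +oo%E.
  apply: le_integral => //; apply/integrableP; split => //.
  rewrite -[X in integral _ _ X]/(abse \o f) fune_abse.
  rewrite ge0_integralD//; [|exact: measurable_funepos|exact: measurable_funeneg].
  by rewrite lte_add_pinfty.
rewrite leye_eq => /eqP fpoo.
rewrite [leRHS]integralE fpoo addye ?leey//.
by rewrite eqe_oppLR/= lt_eqF.
Qed.

(** With density r of rho with respect to mu and q = e^(phi - L) / r, the inequality e^y >= 1 + y
    gives ln r >= phi - L + 1 - q. Integrating against rho suffices, because the integral of q is at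
    most 1. *)
Lemma donsker_varadhan dH (H : measurableType dH) (R : realType)
    (rho mu : probability H R) (phi : H -> R) (L : R) :
  rho.-integrable setT (EFin \o phi) ->
  (\int[mu]_h (expR (phi h))%:E <= (expR L)%:E)%E ->
  (\int[rho]_h (phi h)%:E <= KL rho mu + L%:E)%E.
Proof.
move=> iphi expL; rewrite /KL; case: pselect => rhomu; last by rewrite addye ?leey.
have mphi : measurable_fun setT phi.
  by apply/measurable_EFinP; exact: measurable_int iphi.
pose f := Radon_Nikodym_SigmaFinite.f rho mu.
have f0 h : (0 <= f h)%E by exact: Radon_Nikodym_SigmaFinite.f_ge0.
have ffin h : f h \is a fin_num by exact: Radon_Nikodym_SigmaFinite.f_fin_num.
have mf : measurable_fun setT f.
  by apply: (measurable_int mu); exact: Radon_Nikodym_SigmaFinite.f_integrable.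
have mff : measurable_fun setT (fine \o f) by exact: measurableT_comp.
(* The density may vanish; since [ln 0 = 0 = ln 1], replacing it by 1 there
   leaves [KL] unchanged and makes [ln r] the honest logarithm of [r > 0]. *)
pose r h := if 0 < fine (f h) then fine (f h) else 1.
have r0 h : 0 < r h by rewrite /r; case: ifPn.
have mr : measurable_fun setT r.
  apply: measurable_fun_ifT => //.
  by apply: measurable_fun_ltr => //; exact: measurable_cst.
have mlnr : measurable_fun setT (fun h => ln (r h)).
  exact: (measurableT_comp (@measurable_ln R)).
have -> : (\int[rho]_h (ln (fine (Radon_Nikodym
    (charge_of_finite_measure rho) mu h)))%:E = \int[rho]_h (ln (r h))%:E)%E.
  transitivity (\int[rho]_h (ln (fine (f h)))%:E)%E.
    apply: ae_eq_integral => //.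
    - apply/measurable_EFinP; apply: (measurableT_comp (@measurable_ln R)).
      exact: measurableT_comp.
    - apply/measurable_EFinP; exact: (measurableT_comp (@measurable_ln R)).
    (* The two versions of the density agree mu-almost everywhere, hence rho-almost everywhere by
       absolute continuity. *)
    - have := ae_eq_sym (null_dominates_ae_eq measurableT rhomu
        (ae_eq_Radon_Nikodym_SigmaFinite rhomu measurableT)).
      by apply: filterS => h /(_ I) /= ->.
  apply: eq_integral => h _; congr EFin; rewrite /r.
  have [//|fle0] := ltP 0 (fine (f h)).
  by rewrite ln0// ln1.
pose q h := expR (phi h - L - ln (r h)).
have q0 h : 0 <= q h by exact: expR_ge0.
have mq : measurable_fun setT q.
  apply: (measurableT_comp (@measurable_expR R)).
  by apply: measurable_funB => //; apply: measurable_funB => //; exact: measurable_cst.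
(* Changing measure to mu replaces q by q f, which is e^(phi - L) where f > 0 and 0 where f = 0. *)
have q1 : (\int[rho]_h (q h)%:E <= 1)%E.
  rewrite -(Radon_Nikodym_SigmaFinite.change_of_variables rhomu)//; last first.
    exact/measurable_EFinP.
  apply: (@le_trans _ _ (\int[mu]_h ((expR (- L))%:E * (expR (phi h))%:E))%E).
    apply: ge0_le_integral => //= [h _||| h _].
    + by rewrite mule_ge0// lee_fin.
    + by apply: emeasurable_funM => //; exact/measurable_EFinP.
    + apply: emeasurable_funM => //.
      apply/measurable_EFinP; exact: (measurableT_comp (@measurable_expR R)).
    + rewrite -/f -(fineK (ffin h)) -!EFinM lee_fin -expRD addrC /q [in leLHS]expRB lnK ?posrE// -mulrA.
      rewrite ler_piMr ?expR_ge0// mulrC ler_pdivrMr// mul1r /r.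
      by case: ifPn => //; rewrite -leNgt => /le_trans; apply.
  rewrite ge0_integralZl_EFin ?expR_ge0//; last first.
    apply/measurable_EFinP; exact: (measurableT_comp (@measurable_expR R)).
  apply: (@le_trans _ _ ((expR (- L))%:E * (expR L)%:E)%E).
    by rewrite lee_wpmul2l// lee_fin expR_ge0.
  by rewrite -EFinM -expRD addNr expR0.
have iq : rho.-integrable setT (EFin \o q).
  apply/integrableP; split; first exact/measurable_EFinP.
  under eq_integral => h _ do rewrite /= ger0_norm//.
  by rewrite (le_lt_trans q1) ?ltry.
have ic (k : R) : rho.-integrable setT (EFin \o cst k).
  exact: finite_measure_integrable_cst.
have : (\int[rho]_h ((phi h)%:E + (1 - L)%:E - (q h)%:E) <=
    \int[rho]_h (ln (r h))%:E)%E.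
  apply: le_integral_integrable_minorant.
  - by apply: integrableB => //; apply: integrableD => //; exact: ic.
  - exact/measurable_EFinP.
  - move=> h /=; rewrite lee_fin.
    by have := expR_ge1Dx (phi h - L - ln (r h)); rewrite -/(q h); lra.
rewrite integralB//; [|by apply: integrableD => //; exact: ic].
rewrite integralD//; [|exact: ic].
rewrite integral_cst//= probability_setT mule1.
have qfin : (\int[rho]_h (q h)%:E \is a fin_num)%E by exact: integrable_fin_num.
have pfin : (\int[rho]_h (phi h)%:E \is a fin_num)%E.
  exact: integrable_fin_num.
move: q1; rewrite -(fineK qfin) -(fineK pfin) => q1 le_ln.
rewrite -leeBlDr//; apply: le_trans le_ln.
by rewrite -EFinD -!EFinB lee_fin; move: q1; rewrite lee_fin; lra.
Qed.

(** * Numerical facts: the confidence levels, their sum, and the tuned parameter *)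

Lemma Lt_gt0 (R : realType) (delta : R) t : 0 < delta < 1 -> 0 < Lt delta t.
Proof.
move=> /andP[d0 d1]; rewrite /Lt addrC ltr_wpDr//.
  by rewrite mulr_ge0// ln_ge0// ler1n.
by rewrite ln_gt0// ltr_pdivlMr// mul1r; lra.
Qed.

Lemma expR_LtV (R : realType) (delta : R) t : 0 < delta ->
  (expR (Lt delta t))^-1 = delta / (2 * t.+1%:R ^+ 2).
Proof.
move=> d0; rewrite /Lt expRD expRM_natl !lnK ?posrE ?divr_gt0//.
by move: t.+1%:R (ltr0Sn R t) => a a0; field; rewrite !gt_eqF.
Qed.

(** Telescoping: 1 / (n + 2)^2 <= 1 / (n + 1) - 1 / (n + 2). The index n stands for time n + 1. *)
Lemma nneseries_inv_sqr_le (R : realType) (delta : R) (u : nat -> \bar R) :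
  0 <= delta -> (forall n, 0 <= u n)%E ->
  (forall n, u n <= (delta / n.+2%:R ^+ 2)%:E)%E ->
  (\sum_(0 <= n <oo) u n <= delta%:E)%E.
Proof.
move=> d0 u0 ud; apply: lime_le; first exact: is_cvg_nneseries.
apply: nearW => N.
suff : (\sum_(0 <= n < N) u n <= (delta * (1 - N.+1%:R^-1))%:E)%E.
  move=> /le_trans; apply; rewrite lee_fin ler_piMr//.
elim: N => [|N IH]; first by rewrite big_geq// invr1 subrr mulr0.
rewrite big_nat_recr//= (le_trans (leeD IH (ud N)))// -EFinD lee_fin -mulrDr.
rewrite ler_wpM2l//.
have n1 : 0 < N.+1%:R :> R by [].
have n2 : 0 < N.+2%:R :> R by [].
have n12 : N.+2%:R = N.+1%:R + 1 :> R by rewrite natr1.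
suff : N.+2%:R ^- 2 <= N.+1%:R^-1 - N.+2%:R^-1 :> R.
  by move: (N.+2%:R ^- 2) N.+1%:R^-1 N.+2%:R^-1 => x y z; lra.
have -> : N.+1%:R^-1 - N.+2%:R^-1 = (N.+1%:R * N.+2%:R)^-1 :> R.
  by move: n1 n2; rewrite n12; move: N.+1%:R => a a1 a2; field; rewrite !gt_eqF.
rewrite lef_pV2 ?posrE ?mulr_gt0 ?exprn_gt0// expr2 ler_pM2r// ler_nat.
by [].
Qed.

(** Division of the hypothesis by s: with a, p, q the roots of c, b, L one has s = q / (a p), so 1 /
    s = a p / q, c s = a q / p and L / s = a p q. *)
Lemma sqrt_bound (R : realType) (c b L m k x : R) :
  0 < c -> 0 < b -> 0 < L ->
  let s := Num.sqrt (L / (c * b)) in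
  s * `|m| - c * s ^+ 2 * x <= k + L ->
  `|m| <= Num.sqrt c * (k * Num.sqrt (b / L) + x * Num.sqrt (L / b)
                        + Num.sqrt (L * b)).
Proof.
move=> c0 b0 L0 s.
have [a0 p0 q0] : [/\ 0 < Num.sqrt c, 0 < Num.sqrt b & 0 < Num.sqrt L].
  by rewrite !sqrtr_gt0.
have [c0' b0' L0'] : [/\ 0 <= c, 0 <= b & 0 <= L] by rewrite !ltW.
rewrite /s !sqrtrM// !sqrtrV ?mulr_ge0// sqrtrM//.
have : c = Num.sqrt c ^+ 2 by rewrite sqr_sqrtr.
have : L = Num.sqrt L ^+ 2 by rewrite sqr_sqrtr.
move: (Num.sqrt c) (Num.sqrt b) (Num.sqrt L) a0 p0 q0 => a p q a0 p0 q0 -> ->.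
have [an pn qn] : [/\ a != 0, p != 0 & q != 0] by rewrite !gt_eqF.
move=> h; rewrite -(ler_pM2l (_ : 0 < q / (a * p))) ?divr_gt0 ?mulr_gt0//.
suff -> : q / (a * p) * (a * (k * (p / q) + x * (q / p) + q * p)) =
  k + q ^+ 2 + a ^+ 2 * (q / (a * p)) ^+ 2 * x by rewrite -lerBlDr.
by field; rewrite an pn qn.
Qed.

(** * The deterministic bound at a fixed outcome *)

Section pac_bayes.
Context (R : realType) dH (H : measurableType dH).

Lemma integral_affine_le_KL (rho mu : probability H R) (M V : H -> R) (a b L : R) :
  rho.-integrable setT (EFin \o M) -> rho.-integrable setT (EFin \o V) ->
  (\int[mu]_h (expR (a * M h - b * V h))%:E <= (expR L)%:E)%E ->
  ((a * fine (\int[rho]_h (M h)%:E) - b * fine (\int[rho]_h (V h)%:E))%:E <=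
   KL rho mu + L%:E)%E.
Proof.
move=> iM iV hL.
have iZ (k : R) (f : H -> R) : rho.-integrable setT (EFin \o f) ->
    rho.-integrable setT (EFin \o (fun w => k * f w)).
  move=> ih; rewrite (_ : _ \o _ = fun w => (k%:E * (f w)%:E)%E)//.
  exact: integrableZl.
have iphi : rho.-integrable setT (EFin \o (fun h => a * M h - b * V h)).
  rewrite (_ : _ \o _ = fun h => ((a * M h)%:E - (b * V h)%:E)%E)//.
  by apply: integrableB => //; exact: iZ.
apply: le_trans (donsker_varadhan _ _ _ _ _ _ _ iphi hL).
under [leRHS]eq_integral => h _ do rewrite EFinB.
rewrite integralB//; [|exact: (iZ a M)|exact: (iZ b V)].
under [X in (_ <= X - _)%E]eq_integral => h _ do rewrite EFinM.
under [X in (_ <= _ - X)%E]eq_integral => h _ do rewrite EFinM.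
rewrite !integralZl// EFinB !EFinM !fineK//; exact: integrable_fin_num.
Qed.

Lemma KL_ge0 (rho mu : probability H R) : (0 <= KL rho mu)%E.
Proof.
have := @donsker_varadhan _ _ _ rho mu (cst 0) 0.
rewrite integral0 adde0; apply; first exact: finite_measure_integrable_cst.
under eq_integral => h _ do rewrite expR0.
by rewrite integral_cst//= probability_setT mule1 expR0.
Qed.

(** The exponential-moment bounds for s and -s do not involve [rho], which gives uniformity over
    posteriors; the two signs together control the absolute value. *)
Lemma pac_bayes_bound (rho mu : probability H R) (M V : H -> R) (c b L K : R) :
  0 < c -> 0 < b -> 0 < L ->
  measurable_fun setT M -> (forall h, `|M h| <= K) ->
  measurable_fun setT V -> (forall h, 0 <= V h) ->
  let s := Num.sqrt (L / (c * b)) in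
  (\int[mu]_h (expR (s * M h - c * s ^+ 2 * V h))%:E <= (expR L)%:E)%E ->
  (\int[mu]_h (expR (- s * M h - c * (- s) ^+ 2 * V h))%:E <= (expR L)%:E)%E ->
  (`| \int[rho]_h (M h)%:E | <= (Num.sqrt c)%:E *
     (KL rho mu * (Num.sqrt (b / L))%:E
      + (\int[rho]_h (V h)%:E) * (Num.sqrt (L / b))%:E
      + (Num.sqrt (L * b))%:E))%E.
Proof.
move=> c0 b0 L0 mM MK mV V0 s hp hn.
have iM : rho.-integrable setT (EFin \o M).
  apply: measurable_bounded_integrable => //.
    by rewrite (le_lt_trans (probability_le1 _ _))// ltry.
  exists K; split; first exact: num_real.
  by move=> z Kz h _ /=; rewrite (le_trans (MK h))// ltW.
have sc0 : 0 < Num.sqrt c by rewrite sqrtr_gt0.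
have Vint0 : (0 <= \int[rho]_h (V h)%:E)%E.
  by apply: integral_ge0 => h _; rewrite lee_fin.
(* An infinite variance term makes the right-hand side +oo, since [KL_ge0] excludes a cancelling
   -oo. *)
have [Voo|Vfin] := eqVneq (\int[rho]_h (V h)%:E)%E +oo%E.
  rewrite Voo gt0_mulye ?lte_fin ?sqrtr_gt0 ?divr_gt0//.
  rewrite addey ?addye ?gt0_muley ?leey ?lte_fin//.
  by rewrite gt_eqF// (lt_le_trans ltNy0)// mule_ge0 ?KL_ge0// lee_fin.
have iV : rho.-integrable setT (EFin \o V).
  apply/integrableP; split; first exact/measurable_EFinP.
  under eq_integral => h _ do rewrite /= ger0_norm//.
  by rewrite ltey.
have hp' := integral_affine_le_KL _ _ _ _ _ _ _ iM iV hp.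
have hn' := integral_affine_le_KL _ _ _ _ _ _ _ iM iV hn.
have mfin : (\int[rho]_h (M h)%:E)%E \is a fin_num by exact: integrable_fin_num.
have vfin : (\int[rho]_h (V h)%:E)%E \is a fin_num by exact: integrable_fin_num.
have := KL_ge0 rho mu.
case: (KL rho mu) hp' hn' => [k| |] // hp' hn' _; last first.
  rewrite gt0_mulye ?lte_fin ?sqrtr_gt0 ?divr_gt0//.
  rewrite -(fineK vfin) -EFinM !addye// gt0_muley ?lte_fin//.
  by rewrite leey.
rewrite -(fineK mfin) -(fineK vfin).
rewrite -!EFinM lee_fin.
apply: sqrt_bound => //; rewrite -/s.
move: hp' hn'; rewrite !lee_fin sqrrN.
case: (ger0P (fine (\int[rho]_h (M h)%:E)%E)) => _; lra.
Qed.

End pac_bayes.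

(** * Union bound over times and signs *)

Theorem theorem1 (R : realType)
  (dH : measure_display) (H : measurableType dH)
  (d : measure_display) (Omega : measurableType d)
  (P : probability Omega R)
  (X : nat -> H -> Omega -> R)   (* X t h w, times t >= 1 *)
  (v : nat -> H -> Omega -> R)   (* v t h = E[X_t(h)^2 | T_{t-1}] *)
  (C delta : R)
  (mu : nat -> probability H R) (Vbar : nat -> R) :
  (forall t, (1 <= t)%N ->
     measurable_fun setT (fun p : H * Omega => X t p.1 p.2)) ->
  (forall t, (1 <= t)%N ->
     measurable_fun setT (fun p : H * Omega => v t p.1 p.2)) ->
  (forall t h, (1 <= t)%N ->
     is_cond_exp P (obs_sigma X t.-1) (X t h) (fun _ => 0)) ->
  (forall t h, (1 <= t)%N ->
     is_cond_exp P (obs_sigma X t.-1) (fun w => X t h w ^+ 2) (v t h)) ->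
  (forall t h w, (1 <= t)%N -> 0 <= v t h w) ->
  (forall t h w, (1 <= t)%N -> `|X t h w| <= C) ->
  0 < delta < 1 ->
  (forall t, (1 <= t)%N -> 0 < Vbar t) ->
  (forall t, (1 <= t)%N ->
     Num.sqrt (Lt delta t / ((expR 1 - 2) * Vbar t)) <= C^-1) ->
  exists A : set Omega,
    [/\ measurable A, ((1 - delta)%:E <= P A)%E &
      A `<=` [set w | forall t, (1 <= t)%N -> forall rho : probability H R,
        let M := fun h => \sum_(1 <= tau < t.+1) X tau h w in
        let V := fun h => \sum_(1 <= tau < t.+1) v tau h w in
        (`| \int[rho]_h (M h)%:E | <=
          (Num.sqrt (expR 1 - 2))%:E *
          (KL rho (mu t) * (Num.sqrt (Vbar t / Lt delta t))%:E
           + (\int[rho]_h (V h)%:E) * (Num.sqrt (Lt delta t / Vbar t))%:E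
           + (Num.sqrt (Lt delta t * Vbar t))%:E))%E]].
Proof.
move=> mX mv EX EX2 v0 XC d01 Vb0 lamC.
have d0 : 0 < delta by case/andP: d01.
set c := expR 1 - 2 in lamC *.
have c0 : 0 < c by rewrite subr_gt0 expR1_gt2.
pose s t := Num.sqrt (Lt delta t / (c * Vbar t)).
have s0 t : (1 <= t)%N -> 0 < s t.
  by move=> t1; rewrite sqrtr_gt0 divr_gt0 ?Lt_gt0 ?mulr_gt0 ?Vb0.
(* Positivity of C is read off from 1 / C >= s_1 > 0. *)
have C0 : 0 < C by rewrite -invr_gt0 (lt_le_trans (s0 1 _)) ?lamC.
(* Two times occur: the parameter tuned for t multiplies the increments at every time t'. *)
have absX1 (sg : R) t t' h w : `|sg| = 1 -> (1 <= t)%N -> (1 <= t')%N ->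
    `|sg * s t * X t' h w| <= 1.
  move=> sg1 t1 t'1; have st0 := ltW (s0 t t1).
  rewrite !normrM sg1 mul1r (ger0_norm st0) -(mulVf (lt0r_neq0 C0)).
  by apply: ler_pM => //; [exact: lamC|exact: XC].
pose mix (sg : R) t w := mixture R _ H _ Omega X v (sg * s t) (mu t) t w.
(* Bad event of time n + 1: the mixture for one of the two signs reaches its Markov threshold. Each
   sign costs delta / (2 (n + 2)^2). *)
pose B n := [set w | ((expR (Lt delta n.+1))%:E <= mix 1%R n.+1 w)%E] `|`
            [set w | ((expR (Lt delta n.+1))%:E <= mix (-1)%R n.+1 w)%E].
have mB n : measurable (B n).
  by apply: measurableU; exact: measurable_tail.
have PB n : (P (B n) <= (delta / n.+2%:R ^+ 2)%:E)%E.
  have tail sg : `|sg| = 1 ->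
      (P [set w | (expR (Lt delta n.+1))%:E <= mix sg n.+1 w] <=
       (delta / (2 * n.+2%:R ^+ 2))%:E)%E.
    move=> sg1; rewrite -expR_LtV//.
    apply: mixture_tail => //; last exact: expR_gt0.
    by move=> t h w t1; exact: absX1.
  apply: (le_trans (measureU2 _ _ _)); [exact: measurable_tail..|].
  apply: (le_trans (leeD (tail 1 (normr1 _)) (tail (-1) (normrN1 _)))).
  rewrite -EFinD lee_fin invfM mulrCA -mulrDl.
  by rewrite (_ : 2^-1 + 2^-1 = 1) ?mul1r//; field.
(* The good event is defined through the priors alone, so its measurability involves no intersection
   over all [rho]. *)
exists (~` \bigcup_n B n); split.
- exact/measurableC/bigcup_measurable.
- rewrite probability_setC; last exact: bigcup_measurable.
  rewrite EFinB leeB//.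
  apply: le_trans (nneseries_inv_sqr_le _ _ _ (ltW d0) _ PB) => //.
  by apply: measure_sigma_subadditive => //; exact: bigcup_measurable.
- move=> w nBw t t1 rho /=.
  have mle sg : sg = 1 \/ sg = -1 ->
      (mix sg t w <= (expR (Lt delta t))%:E)%E.
    move=> sgE; rewrite leNgt; apply/negP => mixgt; apply: nBw.
    exists t.-1 => //; rewrite /B prednK//.
    by case: sgE mixgt => -> /ltW; [left|right].
  have mS (Y : nat -> H -> Omega -> R) :
      (forall t, (1 <= t)%N -> measurable_fun setT (fun p : H * Omega => Y t p.1 p.2)) ->
      measurable_fun setT (fun h => \sum_(1 <= tau < t.+1) Y tau h w).
    move=> mY; apply: measurable_sum_nat => tau /andP[tau1 _].
    by have := measurable_fun_pair1 w (mY _ tau1); apply.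
  (* The explicit argument, equal to t C, bounds |M_t(h)| uniformly in h and makes M_t integrable
     under every [rho]. *)
  apply: (pac_bayes_bound _ _ _ _ _ _ _ _ _ _ (\sum_(1 <= tau < t.+1) C)) => //.
  + exact: Vb0.
  + exact: Lt_gt0.
  + exact: mS.
  + move=> h; apply: le_trans (ler_norm_sum _ _ _) _.
    by rewrite !big_nat; apply: ler_sum => tau /andP[tau1 _]; exact: XC.
  + exact: mS.
  + move=> h; rewrite big_nat; apply: sumr_ge0 => tau /andP[tau1 _]; exact: v0.
  + by have := mle 1 (or_introl erefl); rewrite /mix mul1r.
  + by have := mle (-1) (or_intror erefl); rewrite /mix mulN1r.
Qed.
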